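(* Let $\mathcal{H}$ be a Hilbert space of finite dimension $N$, and let $\rho,\sigma$ be density operators on $\mathcal{H}$ with the same spectrum, where $\rho$ is not the maximally mixed state $\mathbb{1}/N$. Let $T>0$, let $t\mapsto H_t$ ($t\in[0,T]$) be a (time-dependent) Hamiltonian generating the unitary evolution $U_t$, and set $\rho_t=U_t\rho U_t^\dagger$, with $\rho_0=\rho$ and $\rho_T=\sigma$. Define $$\Theta(\rho,\sigma)=\arccos\left(\frac{\operatorname{tr}[\rho\sigma]-1/N}{\operatorname{tr}[\rho^2]-1/N}\right),\qquad Q_\Theta=\frac{1}{T}\int_0^T dt\,\sqrt{\frac{2\,\operatorname{tr}[\rho_t^2H_t^2-(\rho_tH_t)^2]}{\operatorname{tr}[\rho_t^2-\mathbb{1}/N^2]}}.$$ Then the evolution time satisfies $T\geq T_\Theta(\rho,\sigma):=\Theta(\rho,\sigma)/Q_\Theta$; i.e., the minimal time required to evolve $\rho$ to $\sigma$ by a unitary generated by $H_t$ is bounded from below by $T_\Theta(\rho,\sigma)$.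
   Context: Units with $\hbar=1$. $\Theta(\rho,\sigma)$ equals the angle $\arccos(\hat{\bm r}\cdot\hat{\bm s})$ between the generalized Bloch vectors $\bm r,\bm s$ of $\rho,\sigma$ (defined by $\rho=\frac1N(\mathbb{1}+\sqrt{N(N-1)/2}\,\bm r\cdot\bm A)$ for a basis $\bm A=(A_1,\dots,A_{N^2-1})$ of the Lie algebra of $SU(N)$ with $\operatorname{tr}[A_iA_j]=2\delta_{ij}$), normalized to unit length; states with equal spectra have Bloch vectors of equal length. The unitary $U_t$ solves $i\,\partial_t U_t=H_tU_t$, $U_0=\mathbb{1}$. *)

(* Defs.v *)
From HB Require Import structures.
From mathcomp Require Import all_boot all_order all_algebra.
From mathcomp Require Import all_classical all_reals all_analysis.
From mathcomp Require Import complex.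
Set Implicit Arguments. Unset Strict Implicit. Unset Printing Implicit Defensive.
Import Order.TTheory GRing.Theory Num.Theory numFieldNormedType.Exports.
Local Open Scope ring_scope.
Local Open Scope classical_set_scope.

Section QSL.
Variable R : realType.
Local Notation C := (R[i]).

Definition adjmx (N : nat) (A : 'M[C]_N) : 'M[C]_N := (map_mx Num.conj A)^T.

Definition is_hermitian (N : nat) (A : 'M[C]_N) : Prop := adjmx A = A.

Definition unitarymx (N : nat) (V : 'M[C]_N) : Prop :=
  V *m adjmx V = 1%:M /\ adjmx V *m V = 1%:M.

Definition is_density (N : nat) (rho : 'M[C]_N) : Prop :=
  [/\ is_hermitian rho,
      (forall v : 'cV[C]_N, 0 <= ((map_mx Num.conj v)^T *m rho *m v) 0 0)
    & \tr rho = 1].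

Definition maxmixed (N : nat) : 'M[C]_N := (N%:R)^-1%:M.

(* Theta(rho, sigma) = arccos ((tr[rho sigma] - 1/N)/(tr[rho^2] - 1/N));
   the traces are real for Hermitian matrices, we take their real part *)
Definition Theta (N : nat) (rho sigma : 'M[C]_N) : R :=
  acos ((complex.Re (\tr (rho *m sigma)) - (N%:R)^-1) /
        (complex.Re (\tr (rho *m rho)) - (N%:R)^-1)).

Definition evolve (N : nat) (U : R -> 'M[C]_N) (rho : 'M[C]_N) (t : R)
  : 'M[C]_N := U t *m rho *m adjmx (U t).

Definition QTheta_integrand (N : nat) (rt Ht : 'M[C]_N) : R :=
  Num.sqrt (2 * complex.Re (\tr (rt *m rt *m (Ht *m Ht) - (rt *m Ht) *m (rt *m Ht)))
            / complex.Re (\tr (rt *m rt - ((N%:R ^+ 2)^-1)%:M))).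

Definition QTheta (N : nat) (T : R) (H U : R -> 'M[C]_N) (rho : 'M[C]_N) : R :=
  T^-1 * Rintegral lebesgue_measure `[0, T]%classic
           (fun t => QTheta_integrand (evolve U rho t) (H t)).

Definition schrodinger_evolution (N : nat) (T : R) (H U : R -> 'M[C]_N) : Prop :=
  [/\ U 0 = 1%:M,
      (forall i j, {within `[0, T]%classic, continuous (fun s : R => complex.Re (U s i j))}),
      (forall i j, {within `[0, T]%classic, continuous (fun s : R => complex.Im (U s i j))})
    & forall t, 0 < t < T -> forall i j,
        let D := (- 'i) *: (H t *m U t) in
        is_derive t 1 (fun s => complex.Re (U s i j)) (complex.Re (D i j)) /\
        is_derive t 1 (fun s => complex.Im (U s i j)) (complex.Im (D i j))].

End QSL.

(* Main.v *)
(* Since rho_t' = - i [H_t, rho_t], the integrand is the speed of the unit vector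
   along rho_t - 1/N, and it dominates the rate of change of the angle between this
   vector and its initial value, by Cauchy-Schwarz on the tangent space of the sphere.
   As nothing is assumed on t |-> H_t, the curve is merely differentiable and its
   speed need not be continuous or bounded; the angle is bounded by the integral of the
   speed by a Vitali-Caratheodory argument, covering the level sets of the speed by
   slightly larger open sets.  The singularities of acos at -1 and 1 are avoided by
   using acos (l * cosine) with l < 1 and letting l tend to 1. *)
Require Import Defs.
From HB Require Import structures.
From mathcomp Require Import all_boot all_order all_algebra.
From mathcomp Require Import all_classical all_reals all_analysis.
From mathcomp Require Import complex.
From mathcomp Require Import measurable_realfun ring.
Import Order.TTheory GRing.Theory Num.Theory.
Local Open Scope ring_scope.
Import numFieldNormedType.Exports.
Local Open Scope classical_set_scope.
Set Implicit Arguments. Unset Strict Implicit. Unset Printing Implicit Defensive.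

(** * Integrating a differential inequality *)

Lemma within_itv_ball (R : realType) (f : R -> R) (a b s e : R) :
  {within `[a, b], continuous f} -> a <= s <= b -> 0 < e ->
  exists2 d, 0 < d & forall x, a <= x <= b -> `|x - s| < d -> `|f x - f s| < e.
Proof.
move=> /subspace_continuousP cf sab e0.
have /cvgrPdist_lt /(_ _ e0) : f @ within `[a, b] (nbhs s) --> f s.
  by apply: cf; rewrite /= in_itv.
rewrite near_withinE => -[d /= d0 dP]; exists d => // x xab xs.
rewrite distrC; apply: dP; last by rewrite /= in_itv.
by rewrite /= distrC.
Qed.

Lemma is_derive_ler_right (R : realType) (f : R -> R) (s l k : R) :
  is_derive s 1 f l -> l < k ->
  exists2 d, 0 < d & forall y, s < y < s + d -> f y - f s <= k * (y - s).
Proof.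
move=> [df <-] lk.
have /cvgrPdist_lt /(_ _ (_ : 0 < k - 'D_1 f s)) := df.
rewrite subr_gt0 => /(_ lk); rewrite near_withinE => -[d /= d0 dP].
exists d => // y /andP[sy ys].
have ys0 : 0 < y - s by rewrite subr_gt0.
have := dP (y - s).
rewrite /= sub0r normrN gtr0_norm// ltrBlDl => /(_ ys) /(_ (lt0r_neq0 ys0)).
rewrite /GRing.scale /= mulr1 subrK -/('D_1 f s) distrC => /ltr_normlW.
by rewrite ltrD2r mulrC ltr_pdivrMr// => /ltW.
Qed.

(** Continuous induction: the points up to which the bound holds with slack [e] have a supremum,
    which satisfies the bound too, and [step] would push past it unless it is [b]. Monotonicity is
    all that is asked of [Phi] as a function. *)
Lemma le_creeping (R : realType) (f : R -> R) (Phi : R -> \bar R) (a b e : R) :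
  a < b -> 0 < e -> {within `[a, b], continuous f} ->
  (forall x y, a <= x -> x <= y -> y <= b -> (Phi x <= Phi y)%E) ->
  (0 <= Phi a)%E ->
  (forall s, a < s < b -> exists2 d, 0 < d & forall y, s < y < s + d -> y <= b ->
     (Phi s + (f y - f s)%:E <= Phi y)%E) ->
  ((f b - f a)%:E <= Phi b + e%:E)%E.
Proof.
move=> ab e0 cf Phi_nd Phia step.
pose S := [set x | a <= x <= b /\ ((f x - f a)%:E <= Phi x + e%:E)%E].
have aS : S a.
  by split; [rewrite lexx ltW|rewrite subrr adde_ge0// lee_fin ltW].
have Sub : ubound S b by move=> x [/andP[]].
have supS : has_sup S by split; [exists a|exists b].
have le_sup x : S x -> x <= sup S.
  by move=> Sx; apply: ub_le_sup => //; exists b.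
have supb : sup S <= b by exact: ge_sup (ex_intro _ a aS) Sub.
(* [step] only speaks of interior points, so the first move away from [a] is paid for by the slack
   [e] and continuity of [f] at [a]. *)
have asup : a < sup S.
  have [|d d0 dP] := within_itv_ball (s := a) cf _ e0; first by rewrite lexx ltW.
  pose x := Num.min b (a + d / 2).
  have d20 : 0 < d / 2 by rewrite divr_gt0.
  have ax : a < x by rewrite lt_min ab ltrDl.
  have xb : x <= b by rewrite ge_min lexx.
  apply: (lt_le_trans ax); apply: le_sup; split; first by rewrite ltW.
  have : `|f x - f a| < e.
    apply: dP; first by rewrite xb ltW.
    rewrite gtr0_norm ?subr_gt0// ltrBlDl (@le_lt_trans _ _ (a + d / 2))//.
      by rewrite ge_min lexx orbT.
    by rewrite ltrD2l ltr_pdivrMr// ltr_pMr// ltr1n.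
  move=> /ltr_normlW/ltW fxa.
  apply: (@le_trans _ _ e%:E); first by rewrite lee_fin.
  by rewrite leeDr// (le_trans Phia)// Phi_nd// ltW.
(* Approach [sup S] from the left within [S]: [f] varies by less than any [k], and [Phi] can only
   increase. *)
have supP : S (sup S).
  split; first by rewrite ltW.
  apply/lee_addgt0Pr => k k0.
  have [|d d0 dP] := within_itv_ball (s := sup S) cf _ k0; first by rewrite supb ltW.
  have [x Sx xd] := sup_adherent d0 supS.
  have xs := le_sup _ Sx.
  case: Sx => /andP[ax xb] fx.
  have : `|f x - f (sup S)| < k.
    by apply: dP; [rewrite ax|rewrite distrC ger0_norm ?subr_ge0// ltrBlDl -ltrBlDr].
  rewrite distrC => /ltr_normlW/ltW fk.
  apply: (@le_trans _ _ ((f x - f a) + k)%:E).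
    by rewrite lee_fin -lerBlDl opprB addrA subrK.
  by rewrite EFinD leeD2r// (le_trans fx)// leeD2r// Phi_nd.
have [bs|sb] := leP b (sup S).
  suff <- : sup S = b by case: supP.
  by apply/eqP; rewrite eq_le supb.
have [|d d0 dP] := step (sup S); first by rewrite asup.
(* Halving [d] keeps [y] strictly inside the range of [step]; that [y] lies in [S] then contradicts
   [sup S < y]. *)
pose y := Num.min b (sup S + d / 2).
have d20 : 0 < d / 2 by rewrite divr_gt0.
have sy : sup S < y by rewrite lt_min sb ltrDl.
have yb : y <= b by rewrite ge_min lexx.
suff : S y by move=> /le_sup; rewrite leNgt sy.
split; first by rewrite yb (le_trans _ (ltW sy))// ltW.
case: supP => _ fs.
have -> : f y - f a = (f (sup S) - f a) + (f y - f (sup S)).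
  by rewrite [RHS]addrC addrA subrK.
rewrite EFinD; apply: (@le_trans _ _ (Phi (sup S) + e%:E + (f y - f (sup S))%:E)%E).
  by rewrite leeD2r.
rewrite addeAC leeD2r// dP// sy /= (@le_lt_trans _ _ (sup S + d / 2))//.
  by rewrite ge_min lexx orbT.
by rewrite ltrD2l ltr_pdivrMr// ltr_pMr// ltr1n.
Qed.

(** * Open covers of level sets and the growth bound *)

Section growth.
Context {R : realType}.
Local Notation mu := (@lebesgue_measure R).

Lemma le_nneseries_term (u : nat -> \bar R) k :
  (forall i, (0 <= u i)%E) -> (u k <= \sum_(i <oo) u i)%E.
Proof.
move=> u0; apply: (@le_trans _ _ (\sum_(0 <= i < k.+1) u i)%E).
  by rewrite big_nat_recr//= leeDr// sume_ge0.
exact: nneseries_lim_ge.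
Qed.

Section cover.
Variables (G : nat -> set R) (c : nat -> R) (a : R).
Hypotheses (mG : forall k, measurable (G k)) (c0 : forall k, 0 <= c k).

(** The integral over [[a, x[] of the sum of the [c k] times the indicators of the [G k]. It serves
    as [Phi] in [le_creeping]; half-open intervals concatenate without overlap. *)
Definition weighted_cover x := (\sum_(k <oo) (c k)%:E * mu (G k `&` `[a, x[))%E.

Let term_ge0 A k : (0 <= (c k)%:E * mu (G k `&` A))%E.
Proof. by rewrite mule_ge0// lee_fin. Qed.

Lemma weighted_cover_ge0 x : (0 <= weighted_cover x)%E.
Proof. by apply: nneseries_ge0 => *; exact: term_ge0. Qed.

Lemma weighted_coverD x y : a <= x -> x <= y ->
  (weighted_cover y =
   weighted_cover x + \sum_(k <oo) (c k)%:E * mu (G k `&` `[x, y[))%E.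
Proof.
move=> ax xy; rewrite /weighted_cover -nneseriesD; last 2 first.
  by move=> *; exact: term_ge0.
  by move=> *; exact: term_ge0.
apply: eq_eseriesr => k _; rewrite -ge0_muleDr//; congr (_ * _)%E.
have -> : `[a, y[%classic = `[a, x[ `|` `[x, y[ :> set R.
  by rewrite -itv_bndbnd_setU// bnd_simp.
rewrite setIUr measureU => [//| | |]; try by apply: measurableI => //; exact: mG.
apply/seteqP; split => // z [[_ /=]] + [_ /=].
by rewrite !in_itv /= => /andP[_ zx] /andP[xz _]; have := lt_le_trans zx xz; rewrite ltxx.
Qed.

Lemma weighted_cover_le x y : a <= x -> x <= y ->
  (weighted_cover x <= weighted_cover y)%E.
Proof.
move=> ax xy; rewrite (weighted_coverD ax xy) leeDl//.
by apply: nneseries_ge0 => *; exact: term_ge0.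
Qed.

Lemma weighted_cover_incr x y k : a <= x -> x <= y -> `[x, y[ `<=` G k ->
  (weighted_cover x + (c k * (y - x))%:E <= weighted_cover y)%E.
Proof.
move=> ax xy xyG; rewrite (weighted_coverD ax xy) leeD2l//.
(* Of the whole series, only the term of index [k] is kept. *)
apply: le_trans (le_nneseries_term k _); last by move=> *; exact: term_ge0.
move/setIidPr: xyG => ->; rewrite lebesgue_measure_itv /= lte_fin.
case: ltrP => [_|yx]; first by rewrite -EFinB -EFinM.
by rewrite (_ : y = x) ?subrr ?mulr0 ?mule0//; apply/eqP; rewrite eq_le yx.
Qed.

End cover.

(** Vitali-Caratheodory: slice []a, b[] into level sets [E k] of [g] of height [e] and enlarge each
    to an open [G k]. The weights exceed [g] by at most [2 * e] on the slices, costing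
    [2 * e * (b - a)], and the enlargements cost [e] in all. *)
Lemma integral_majorant_cover (g : R -> R) (a b e : R) : a < b -> 0 < e ->
  measurable_fun `]a, b[ g -> (forall x, a < x < b -> 0 <= g x) ->
  exists (G : nat -> set R) (c : nat -> R),
    [/\ forall k, open (G k), forall k, 0 < c k,
        forall x, a < x < b -> exists2 k, G k x & g x < c k
      & (weighted_cover G c a b <=
         \int[mu]_(x in `]a, b[) (g x)%:E + (e * (2 * (b - a) + 1))%:E)%E].
Proof.
move=> ab e0 mg g0.
pose c k : R := k.+2%:R * e.
have c0 k : 0 < c k by rewrite mulr_gt0.
pose E k := `]a, b[ `&` g @^-1` `[k%:R * e, k.+1%:R * e[.
have mE k : measurable (E k) by apply: mg.
have Efin k : (mu (E k) < +oo)%E.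
  apply: (@le_lt_trans _ _ (mu `]a, b[)).
    by apply: le_measure; rewrite ?inE; [exact: mE|exact: measurable_itv|move=> x []].
  by rewrite lebesgue_measure_itv /= lte_fin ab -EFinB ltry.
have abE x : a < x < b -> E (Num.truncn (g x / e)) x.
  move=> xab; split => /=; first by rewrite in_itv.
  by rewrite in_itv /= -ler_pdivlMr// -ltr_pdivrMr// truncn_itv// divr_ge0 ?g0 ?ltW.
(* The excess measure allowed for [G k]: after weighting by [c k] it becomes [e / 2 ^ k.+1], whose
   sum over [k] is [e]. *)
have dlt k : 0 < e / (2 ^ k.+1)%:R / c k.
  by rewrite divr_gt0// divr_gt0// ltr0n expn_gt0.
pose G k := sval (cid (lebesgue_regularity_outer (mE k) (Efin k) (dlt k))).
have GP k : [/\ open (G k), E k `<=` G k &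
    (mu (G k `\` E k) < (e / (2 ^ k.+1)%:R / c k)%:E)%E].
  by rewrite /G; case: cid.
have oG k : open (G k) by case: (GP k).
have mG k : measurable (G k) by exact: open_measurable.
exists G, c; split => //.
  move=> x xab; exists (Num.truncn (g x / e)).
    by case: (GP (Num.truncn (g x / e))) => _ + _; apply; exact: abE.
  case: (abE _ xab) => _ /=; rewrite in_itv /= => /andP[_ /lt_le_trans]; apply.
  by rewrite ler_pM2r// ler_nat.
have mg2 : measurable_fun `]a, b[ (fun x => (g x + 2 * e)%:E).
  by apply/measurable_EFinP; apply: measurable_funD => //.
have g20 x : `]a, b[ x -> (0 <= (g x + 2 * e)%:E)%E.
  by move=> /= xab; rewrite lee_fin addr_ge0 ?mulr_ge0 ?g0// ltW.
have EG : \bigcup_k E k = `]a, b[.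
  apply/seteqP; split => [x [k _ []]//|x /= xab].
  by exists (Num.truncn (g x / e)) => //; apply: abE; rewrite in_itv in xab.
have trivE : trivIset setT E.
  apply/trivIsetP => i j _ _ ij; apply/seteqP; split => // x [[/= _ gi] [_ /= gj]].
  suff ij' : forall i j, (i < j)%N -> g x \in `[i%:R * e, i.+1%:R * e[%R ->
      g x \in `[j%:R * e, j.+1%:R * e[%R -> False.
    case: (ltngtP i j) ij => // lt _; [exact: (ij' i j)|exact: (ij' j i)].
  move=> m n mn; rewrite !in_itv /= => /andP[_ gm] /andP[gn _].
  have := le_lt_trans gn gm; rewrite ltr_pM2r// ltr_nat.
  by rewrite ltnS leqNgt mn.
(* The error [2 * e * (b - a)] is absorbed into the integrand as the constant [2 * e], so that the
   comparison can be made slice by slice. *)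
have -> : (\int[mu]_(x in `]a, b[) (g x)%:E + (e * (2 * (b - a) + 1))%:E =
    \sum_(k <oo) \int[mu]_(x in E k) (g x + 2 * e)%:E + e%:E)%E.
  rewrite -ge0_integral_bigcup ?EG//.
  under [in RHS]eq_integral do rewrite EFinD.
  rewrite ge0_integralD//; last 2 first.
  - exact/measurable_EFinP.
  - by move=> x _; rewrite lee_fin mulr_ge0// ltW.
  rewrite integral_cst//= lebesgue_measure_itv /= lte_fin ab.
  suff -> : e * (2 * (b - a) + 1) = 2 * e * (b - a) + e by rewrite EFinD addeA EFinM EFinB.
  by rewrite mulrDr mulr1 mulrA [e * 2]mulrC.
apply: (@le_trans _ _ (\sum_(k <oo) (\int[mu]_(x in E k) (g x + 2 * e)%:E +
    (e / (2 ^ k.+1)%:R)%:E))%E); last first.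
  apply: epsilon_trick; last exact: ltW.
  by move=> k; apply: integral_ge0 => x [xab _]; exact: g20.
apply: lee_nneseries => k _; first by rewrite mule_ge0// lee_fin ltW.
case: (GP k) => _ EGk GE.
have -> : (e / (2 ^ k.+1)%:R) = c k * (e / (2 ^ k.+1)%:R / c k).
  by rewrite [RHS]mulrCA divff ?mulr1// gt_eqF.
(* Split the part of [G k] in [[a, b[] into the slice itself and the excess, each bounded
   separately. *)
apply: (@le_trans _ _ ((c k)%:E * mu (E k) + (c k)%:E * mu (G k `\` E k))%E).
  rewrite -ge0_muleDr//; apply: lee_wpmul2l; first by rewrite lee_fin ltW.
  have mGE : measurable (G k `\` E k) by exact: measurableD.
  have -> : (mu (E k) + mu (G k `\` E k) = mu (E k `|` (G k `\` E k)))%E.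
    by rewrite measureU; [|exact: mE|exact: mGE|rewrite setDE setICA setICr setI0].
  apply: le_measure; rewrite ?inE; [|apply: measurableU; [exact: mE|exact: mGE]|].
    by apply: measurableI => //; exact: mG.
  by move=> x [Gx _]; case: (pselect (E k x)); [left|right].
apply: leeD; last by rewrite [X in (_ <= X)%E]EFinM lee_wpmul2l ?lee_fin ?ltW.
have -> : ((c k)%:E * mu (E k) = \int[mu]_(x in E k) (c k)%:E)%E.
  by rewrite integral_cst; [|exact: mE].
apply: ge0_le_integral; first exact: mE.
- by move=> x _; rewrite lee_fin ltW.
- exact: measurable_cst.
- by apply: measurable_funS mg2; [exact: measurable_itv|move=> x []].
(* On the slice, [k * e <= g x], hence [(k + 2) * e <= g x + 2 * e]. *)
move=> x [_ /=]; rewrite in_itv /= => /andP[kg _].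
rewrite lee_fin /c -[k.+2%:R]natr1 -natr1 -addrA mulrDl (_ : 1 + 1 = 2)//.
by rewrite lerD2r.
Qed.

(** At each interior [s] some open [G k] contains [s] with [df s <= g s < c k]. Just to the right of
    [s], [f] grows with slope at most [c k] and the weighted cover with slope at least [c k], which
    is the step of [le_creeping]. *)
Lemma le_integral_majorant (f df g : R -> R) (a b : R) : a < b ->
  {within `[a, b], continuous f} ->
  (forall x, a < x < b -> is_derive x 1 f (df x)) ->
  (forall x, a < x < b -> df x <= g x) ->
  (forall x, a < x < b -> 0 <= g x) ->
  measurable_fun `]a, b[ g ->
  ((f b - f a)%:E <= \int[mu]_(x in `]a, b[) (g x)%:E)%E.
Proof.
move=> ab cf fdf dfg g0 mg; apply/lee_addgt0Pr => r r0.
have den0 : 0 < 2 * (b - a) + 2 by rewrite addr_gt0// mulr_gt0// subr_gt0.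
(* Chosen so that the cover error [e * (2 * (b - a) + 1)] and the creeping slack [e] add up to
   [r]. *)
pose e := r / (2 * (b - a) + 2).
have e0 : 0 < e by rewrite divr_gt0.
have [G [c [oG c0 Gg Gi]]] := integral_majorant_cover ab e0 mg g0.
have mG k : measurable (G k) by exact: open_measurable.
have c0' k : 0 <= c k by exact: ltW.
apply: (@le_trans _ _ (weighted_cover G c a b + e%:E)%E); last first.
  have -> : r = e * (2 * (b - a) + 1) + e.
    by rewrite -[X in _ + X]mulr1 -mulrDr -addrA /e divfK// gt_eqF.
  by rewrite EFinD addeA leeD2r.
apply: le_creeping => //.
- by move=> x y ax xy yb; apply: weighted_cover_le.
- exact: weighted_cover_ge0.
move=> s sab; have /andP[as_ sb] := sab.
have [k Gs gk] := Gg _ sab.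
have [d1 d10 d1P] := is_derive_ler_right (fdf _ sab) (le_lt_trans (dfg _ sab) gk).
have [d2 /= d20 d2P] : nbhs_ball s (G k).
  by apply/nbhs_ballP; exact: open_nbhs_nbhs.
exists (Num.min d1 d2) => [|y /andP[sy ys] yb]; first by rewrite lt_min d10.
have ys1 : y < s + d1 by rewrite (lt_le_trans ys)// lerD2l ge_min lexx.
have ys2 : y < s + d2 by rewrite (lt_le_trans ys)// lerD2l ge_min lexx orbT.
apply: (@le_trans _ _ (weighted_cover G c a s + (c k * (y - s))%:E)%E).
  by rewrite leeD2l// lee_fin d1P// sy.
apply: weighted_cover_incr => //; try exact: ltW.
move=> x /=; rewrite in_itv /= => /andP[sx xy]; apply: d2P.
rewrite /ball /= distrC ger0_norm ?subr_ge0// ltrBlDl.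
exact: lt_trans ys2.
Qed.

End growth.

(** * Growth of the arccosine along a curve *)

Section acos_growth.
Context {R : realType}.
Local Notation mu := (@lebesgue_measure R).

(** Continuity of [acos] at the endpoints is avoided by taking [l = cos d], so that [acos l = d]:
    the hypothesis becomes [cos (I + d) <= cos d * x], and continuity of [cos] gives [cos I <= x] as
    [d] tends to 0 from the right. *)
Lemma le_acos_of_shrink (x I : R) : -1 <= x <= 1 -> 0 <= I ->
  (forall l, 0 < l < 1 -> acos (l * x) - acos l <= I) -> acos x <= I.
Proof.
move=> x11 I0 H.
(* Below [pi], the angle [I + d] stays in [[0, pi]] for small [d], where [cos] is strictly
   decreasing. *)
have [piI|Ipi] := leP pi I; first exact: le_trans (acos_lepi x11) piI.
have [ax0 axpi] := (acos_ge0 x11, acos_lepi x11).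
rewrite leNgt; apply/negP => Iax.
have : cos (acos x) < cos I.
  by rewrite ltr_cos ?in_itv/= ?ax0 ?I0 ?(ltW Ipi).
rewrite acosK ?in_itv// ltNge => /negP; apply.
have cvg0 : cos (I + d) - cos d * x @[d --> (0:R)^'+] --> cos (I + 0) - cos 0 * x.
  apply: cvg_at_right_filter; apply: cvgB.
    apply: continuous_comp; last exact: continuous_cos.
    by apply: cvgD; [exact: cvg_cst|exact: cvg_id].
  by apply: cvgMl; exact: continuous_cos.
rewrite addr0 cos0 mul1r in cvg0.
rewrite -subr_le0; apply: (cvgr_to_le cvg0).
near=> d.
have d0 : 0 < d by near: d; exact: nbhs_right_gt.
have dpi2 : d < pi / 2 by near: d; apply: nbhs_right_lt; rewrite divr_gt0// pi_gt0.
have Idpi : I + d < pi.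
  rewrite -ltrBrDl; near: d; apply: nbhs_right_lt; by rewrite subr_gt0.
have dpi : d <= pi by rewrite (le_trans _ (ltW Idpi))// lerDr.
have l0 : 0 < cos d.
  by apply: cos_gt0_pihalf; rewrite dpi2 andbT (lt_trans _ d0)// oppr_lt0 divr_gt0// pi_gt0.
have l1 : cos d < 1.
  rewrite -cos0 ltr_cos ?in_itv//=; first by rewrite lexx pi_ge0.
  by rewrite ltW.
have lx : -1 <= cos d * x <= 1.
  by rewrite -ler_norml normrM gtr0_norm// mulr_ile1 ?(ltW l0) ?(ltW l1) ?normr_ge0// ler_norml x11.
have HI : acos (cos d * x) <= I + d.
  have dI : d \in `[0, pi]%R by rewrite in_itv /= (ltW d0).
  by rewrite -lerBlDr -[X in _ - X](cosK dI) H// l0.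
rewrite subr_le0 -[leRHS]acosK ?in_itv// leNgt; apply/negP.
rewrite ltr_cos ?in_itv/=; last 2 first.
  by rewrite addr_ge0 ?(ltW d0)//= (ltW Idpi).
  by rewrite acos_ge0 ?acos_lepi.
by apply/negP; rewrite -leNgt.
Unshelve. all: end_near. Qed.

Lemma acos_le_integral (c dc g : R -> R) (T : R) : 0 < T ->
  {within `[0, T], continuous c} ->
  (forall t, 0 < t < T -> is_derive t 1 c (dc t)) ->
  c 0 = 1 -> (forall t, 0 <= t <= T -> -1 <= c t <= 1) ->
  (forall t, 0 < t < T -> 0 <= g t) ->
  (forall t, 0 < t < T -> `|dc t| <= g t * Num.sqrt (1 - c t ^+ 2)) ->
  measurable_fun `]0, T[ g ->
  ((acos (c T))%:E <= \int[mu]_(t in `]0%R, T[) (g t)%:E)%E.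
Proof.
move=> T0 cc dcc c01 c11 g0 dcg mg.
have ig0 : (0 <= \int[mu]_(t in `]0%R, T[) (g t)%:E)%E.
  by apply: integral_ge0 => t /=; rewrite in_itv /= lee_fin; exact: g0.
have key l : 0 < l < 1 ->
    ((acos (l * c T) - acos l)%:E <= \int[mu]_(t in `]0%R, T[) (g t)%:E)%E.
  move=> /andP[l0 l1].
  have lc t : 0 <= t <= T -> -1 < l * c t < 1.
    move=> /c11 ct; rewrite -ltr_norml normrM gtr0_norm//.
    by rewrite (@le_lt_trans _ _ l)// ler_piMr ?(ltW l0)// ler_norml.
  have -> : acos l = acos (l * c 0) by rewrite c01 mulr1.
  apply: (@le_integral_majorant R (fun t => acos (l * c t))
    (fun t => - (Num.sqrt (1 - (l * c t) ^+ 2))^-1 * (l * dc t))) => //.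
  - apply: (@within_continuous_comp _ _ _ `[0, T]%classic (fun t => l * c t) acos).
      move=> _ /set_mem[t /= tT <-]; apply: continuous_acos; apply: lc.
      by rewrite in_itv in tT.
    by move=> t; apply: cvgMr; exact: cc.
  - move=> t tT; apply: (@is_derive1_comp _ acos (fun t => l * c t)).
      by apply: is_derive1_acos; apply: lc; case/andP: tT => *; rewrite !ltW.
    have := dcc _ tT => dct.
    exact: (is_deriveZ l dct).
  move=> t tT; have tT' : 0 <= t <= T by case/andP: tT => *; rewrite !ltW.
  have lc1 := lc _ tT'.
  have s0 : 0 < 1 - (l * c t) ^+ 2 by rewrite subr_gt0 -real_normK ?num_real// expr_lt1// ltr_norml.
  apply: le_trans (ler_norm _) _.
  rewrite normrM normrN normfV (gtr0_norm (_ : 0 < Num.sqrt _)) ?sqrtr_gt0//.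
  rewrite ler_pdivrMl ?sqrtr_gt0// normrM gtr0_norm// [leRHS]mulrC.
  (* The chain is [l * |dc t| <= |dc t| <= g t * sqrt (1 - c t ^ 2) <= g t * sqrt (1 - (l * c t) ^
     2)]. *)
  apply: (@le_trans _ _ (`|dc t|)); first by rewrite ler_piMl// ltW.
  apply: le_trans (dcg _ tT) _; rewrite ler_wpM2l ?g0//.
  apply: ler_wsqrtr; rewrite lerD2l lerN2 exprMn ler_piMl ?sqr_ge0//.
  by rewrite expr_le1// ltW.
(* An infinite integral bounds everything; a finite one lets [l] tend to 1. *)
case: (\int[mu]_(t in `]0%R, T[) (g t)%:E)%E ig0 key => [I| |] // I0 key.
  rewrite lee_fin; apply: le_acos_of_shrink => //; first by apply: c11; rewrite ltW//= lexx.
  by rewrite leey.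
Qed.

End acos_growth.

(** * Measurability of a derivative *)

Lemma measurable_fun_derivative (R : realType) (f df : R -> R) (a b : R) :
  {within `[a, b], continuous f} ->
  (forall x, a < x < b -> is_derive x 1 f (df x)) ->
  measurable_fun `]a, b[ df.
Proof.
move=> cf fdf; pose F := f \_ `[a, b].
have mF : measurable_fun setT F.
  apply/(measurable_restrictT f); first exact: measurable_itv.
  by apply: subspace_continuous_measurable_fun => //; exact: measurable_itv.
(* Forward difference quotients of the extension of [f] by zero are measurable on the whole line. At
   an interior point both arguments eventually lie in [[a, b]], so they converge to [df]. *)
pose h n x := n.+1%:R * (F (x + n.+1%:R^-1) - F x).
apply: (@measurable_fun_cvg _ _ _ _ h).
  move=> n; apply: measurable_funTS; apply: measurable_funM => //.
  apply: measurable_funB => //; apply: measurableT_comp => //.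
  exact: measurable_funD.
move=> x /=; rewrite in_itv /= => xab; have /andP[ax xb] := xab.
have FE y : a <= y <= b -> F y = f y.
  by move=> yab; rewrite /F patchT// inE /= in_itv.
have [dfx dfE] := fdf _ xab.
apply/cvgrPdist_lt => e e0.
have /cvgrPdist_lt /(_ _ e0) := dfx.
rewrite near_withinE -/('D_1 f x) dfE => -[d /= d0 dP].
have bx : 0 < b - x by rewrite subr_gt0.
near=> n.
have n0 : (0 : R) < n.+1%:R^-1 by rewrite invr_gt0.
have nd : n.+1%:R^-1 < d by near: n; exact: near_infty_natSinv_lt (PosNum d0).
have nb : n.+1%:R^-1 < b - x.
  by near: n; exact: near_infty_natSinv_lt (PosNum bx).
have := dP n.+1%:R^-1.
rewrite /= sub0r normrN gtr0_norm// => /(_ nd) /(_ (lt0r_neq0 n0)).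
rewrite /GRing.scale /= mulr1 invrK [_ + x]addrC /h !FE//.
  by rewrite !ltW.
rewrite (le_trans (ltW ax)) ?lerDl ?(ltW n0)//=.
by rewrite addrC -lerBrDr ltW.
Unshelve. all: end_near. Qed.

(** * Entrywise derivatives of complex matrices *)

Section primitive.
Context {R : realType}.
Variable T : R.
Local Notation C := (R[i]).

(** Exactly the regularity granted by [schrodinger_evolution]: continuity up to the endpoints, a
    derivative only in the interior. *)
Definition primitive (f df : R -> R) : Prop :=
  {within `[0, T], continuous f} /\
  forall t, 0 < t < T -> is_derive t 1 f (df t).

Lemma primitive_ext (f g df dg : R -> R) : f =1 g ->
  (forall t, 0 < t < T -> df t = dg t) -> primitive f df -> primitive g dg.
Proof.
by move=> /funext -> dfg [cg gg]; split => // t tT; rewrite -dfg//; exact: gg.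
Qed.

Lemma primitive_cst (k : R) : primitive (fun=> k) (fun=> 0).
Proof.
split; last by move=> t _; exact: is_derive_cst.
by apply: continuous_subspaceT => x; exact: cvg_cst.
Qed.

Lemma primitiveD f g df dg : primitive f df -> primitive g dg ->
  primitive (fun t => f t + g t) (fun t => df t + dg t).
Proof.
move=> [cf ff] [cg gg]; split; first by move=> t; apply: cvgD; [exact: cf|exact: cg].
by move=> t tT; apply: is_deriveD; [exact: ff|exact: gg].
Qed.

Lemma primitiveN f df : primitive f df ->
  primitive (fun t => - f t) (fun t => - df t).
Proof.
move=> [cf ff]; split; first by move=> t; apply: cvgN; exact: cf.
by move=> t tT; apply: is_deriveN; exact: ff.
Qed.

Lemma primitiveM f g df dg : primitive f df -> primitive g dg ->
  primitive (fun t => f t * g t) (fun t => f t * dg t + df t * g t).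
Proof.
move=> [cf ff] [cg gg]; split; first by move=> t; apply: cvgM; [exact: cf|exact: cg].
move=> t tT; rewrite [df t * _]mulrC.
exact: (is_deriveM (ff _ tT) (gg _ tT)).
Qed.

Definition cprimitive (F dF : R -> C) : Prop :=
  primitive (fun t => complex.Re (F t)) (fun t => complex.Re (dF t)) /\
  primitive (fun t => complex.Im (F t)) (fun t => complex.Im (dF t)).

Lemma ReD (x y : C) : complex.Re (x + y) = complex.Re x + complex.Re y.
Proof. by case: x; case: y. Qed.

Lemma ImD (x y : C) : complex.Im (x + y) = complex.Im x + complex.Im y.
Proof. by case: x; case: y. Qed.

Lemma ReM (x y : C) : complex.Re (x * y) =
  complex.Re x * complex.Re y - complex.Im x * complex.Im y.
Proof. by case: x; case: y. Qed.

Lemma ImM (x y : C) : complex.Im (x * y) =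
  complex.Re x * complex.Im y + complex.Im x * complex.Re y.
Proof. by case: x; case: y. Qed.

Lemma cprimitive_cst (k : C) : cprimitive (fun=> k) (fun=> 0).
Proof. by split; exact: primitive_cst. Qed.

Lemma cprimitiveD F G dF dG : cprimitive F dF -> cprimitive G dG ->
  cprimitive (fun t => F t + G t) (fun t => dF t + dG t).
Proof.
move=> [F1 F2] [G1 G2]; split.
  by apply: primitive_ext (primitiveD F1 G1) => t *; rewrite ReD.
by apply: primitive_ext (primitiveD F2 G2) => t *; rewrite ImD.
Qed.

Lemma cprimitiveM F G dF dG : cprimitive F dF -> cprimitive G dG ->
  cprimitive (fun t => F t * G t) (fun t => F t * dG t + dF t * G t).
Proof.
move=> [F1 F2] [G1 G2]; split.
  apply: primitive_ext (primitiveD (primitiveM F1 G1) (primitiveN (primitiveM F2 G2))) => t *.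
    by rewrite ReM.
  by rewrite ReD !ReM opprD addrACA.
apply: primitive_ext (primitiveD (primitiveM F1 G2) (primitiveM F2 G1)) => t *.
  by rewrite ImM.
by rewrite ImD !ImM addrACA.
Qed.

Lemma cprimitive_conj F dF : cprimitive F dF ->
  cprimitive (fun t => Num.conj (F t)) (fun t => Num.conj (dF t)).
Proof.
move=> [F1 F2]; split.
  by apply: primitive_ext F1 => t * /=; [case: (F t)|case: (dF t)].
by apply: primitive_ext (primitiveN F2) => t * /=; [case: (F t)|case: (dF t)].
Qed.

Lemma cprimitive_sum (I : Type) (s : seq I) (F dF : I -> R -> C) :
  (forall i, cprimitive (F i) (dF i)) ->
  cprimitive (fun t => \sum_(i <- s) F i t) (fun t => \sum_(i <- s) dF i t).
Proof.
move=> FF; elim: s => [|i s IH].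
  under eq_fun do rewrite big_nil; under [X in cprimitive _ X]eq_fun do rewrite big_nil.
  exact: cprimitive_cst.
under eq_fun do rewrite big_cons; under [X in cprimitive _ X]eq_fun do rewrite big_cons.
exact: cprimitiveD.
Qed.

Definition mxprimitive m n (F dF : R -> 'M[C]_(m, n)) : Prop :=
  forall i j, cprimitive (fun t => F t i j) (fun t => dF t i j).

Lemma mxprimitive_ext m n (F dF dG : R -> 'M[C]_(m, n)) :
  (forall t, 0 < t < T -> dF t = dG t) -> mxprimitive F dF -> mxprimitive F dG.
Proof.
by move=> FG FF i j; case: (FF i j) => F1 F2; split;
  [apply: primitive_ext F1|apply: primitive_ext F2] => // t tT; rewrite FG.
Qed.

Lemma mxprimitive_cst m n (A : 'M[C]_(m, n)) : mxprimitive (fun=> A) (fun=> 0).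
Proof.
by move=> i j; under [X in cprimitive _ X]eq_fun do rewrite mxE; exact: cprimitive_cst.
Qed.

Lemma mxprimitiveM m n p (F dF : R -> 'M[C]_(m, n)) (G dG : R -> 'M[C]_(n, p)) :
  mxprimitive F dF -> mxprimitive G dG ->
  mxprimitive (fun t => F t *m G t) (fun t => F t *m dG t + dF t *m G t).
Proof.
move=> FF GG i j; under eq_fun do rewrite mxE.
under [X in cprimitive _ X]eq_fun do rewrite !mxE -big_split /=.
by apply: cprimitive_sum => k; exact: cprimitiveM.
Qed.

Lemma mxprimitive_adj n (F dF : R -> 'M[C]_n) : mxprimitive F dF ->
  mxprimitive (fun t => adjmx (F t)) (fun t => adjmx (dF t)).
Proof.
move=> FF i j; under eq_fun do rewrite !mxE.
under [X in cprimitive _ X]eq_fun do rewrite !mxE.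
exact: cprimitive_conj.
Qed.

Lemma mxprimitive_trace n (F dF : R -> 'M[C]_n) : mxprimitive F dF ->
  cprimitive (fun t => \tr (F t)) (fun t => \tr (dF t)).
Proof. by move=> FF; exact: cprimitive_sum. Qed.

Lemma primitive0_const (f df : R -> R) t : primitive f df ->
  (forall s, 0 < s < T -> df s = 0) -> 0 <= t <= T -> f t = f 0.
Proof.
move=> [cf ff] df0 /andP[t0 tT].
move: t0; rewrite le_eqVlt => /predU1P[<- //|t0].
have ff' s : s \in `]0, t[%R -> is_derive s 1 f (df s).
  by rewrite in_itv /= => /andP[s0 /lt_le_trans st]; apply: ff; rewrite s0 st.
have cf' : {within `[0, t], continuous f}.
  by apply: continuous_subspaceW cf; apply: subset_itvl; rewrite bnd_simp.
have [s] := MVT t0 ff' cf'; rewrite in_itv /= => /andP[s0 st].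
by rewrite df0 ?s0 ?(lt_le_trans st)// mul0r => /eqP; rewrite subr_eq0 => /eqP.
Qed.

End primitive.

(** * The trace inner product *)

Section hermitian.
Context {R : realType} {N : nat}.
Local Notation C := (R[i]).
Implicit Types A B X H : 'M[C]_N.

(** On Hermitian matrices this is the Hilbert-Schmidt inner product, the adjoint of [A] being [A]
    itself. *)
Definition hsdot A B : R := complex.Re (\tr (A *m B)).

Lemma ReN (x : C) : complex.Re (- x) = - complex.Re x.
Proof. by case: x. Qed.

Lemma hsdotC A B : hsdot A B = hsdot B A.
Proof. by rewrite /hsdot mxtrace_mulC. Qed.

Lemma hsdotDr A B X : hsdot A (B + X) = hsdot A B + hsdot A X.
Proof. by rewrite /hsdot mulmxDr mxtraceD ReD. Qed.

Lemma hsdotNr A B : hsdot A (- B) = - hsdot A B.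
Proof. by rewrite /hsdot mulmxN raddfN /= ReN. Qed.

Lemma hsdotZr A B (k : R) : hsdot A (k%:C%C *: B) = k * hsdot A B.
Proof. by rewrite /hsdot -scalemxAr mxtraceZ ReM /= mul0r subr0. Qed.

Lemma hsdotDl A B X : hsdot (A + B) X = hsdot A X + hsdot B X.
Proof. by rewrite hsdotC hsdotDr ![hsdot X _]hsdotC. Qed.

Lemma hsdotNl A B : hsdot (- A) B = - hsdot A B.
Proof. by rewrite hsdotC hsdotNr hsdotC. Qed.

Lemma hsdotZl A B (k : R) : hsdot (k%:C%C *: A) B = k * hsdot A B.
Proof. by rewrite hsdotC hsdotZr hsdotC. Qed.

Lemma adjmxK A : adjmx (adjmx A) = A.
Proof. by apply/matrixP => i j; rewrite !mxE conjCK. Qed.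

Lemma adjmxD A B : adjmx (A + B) = adjmx A + adjmx B.
Proof. by apply/matrixP => i j; rewrite !mxE rmorphD. Qed.

Lemma adjmxN A : adjmx (- A) = - adjmx A.
Proof. by apply/matrixP => i j; rewrite !mxE rmorphN. Qed.

Lemma adjmxZ (k : C) A : adjmx (k *: A) = Num.conj k *: adjmx A.
Proof. by apply/matrixP => i j; rewrite !mxE rmorphM. Qed.

Lemma adjmxM A B : adjmx (A *m B) = adjmx B *m adjmx A.
Proof. by rewrite /adjmx map_mxM trmx_mul. Qed.

Lemma adjmx_scalar (k : C) : adjmx (k%:M : 'M[C]_N) = (Num.conj k)%:M.
Proof. by rewrite /adjmx map_scalar_mx tr_scalar_mx. Qed.

Lemma hermitianD A B : is_hermitian A -> is_hermitian B -> is_hermitian (A + B).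
Proof. by rewrite /is_hermitian adjmxD => -> ->. Qed.

Lemma hermitianN A : is_hermitian A -> is_hermitian (- A).
Proof. by rewrite /is_hermitian adjmxN => ->. Qed.

Lemma hermitianZ A (k : R) : is_hermitian A -> is_hermitian (k%:C%C *: A).
Proof.
rewrite /is_hermitian adjmxZ => ->; congr (_ *: _).
by apply/eqP; rewrite eq_complex /= oppr0 !eqxx.
Qed.

Lemma hsdot_herm A : is_hermitian A ->
  hsdot A A = \sum_i \sum_j (complex.Re (A i j) ^+ 2 + complex.Im (A i j) ^+ 2).
Proof.
move=> hA; rewrite /hsdot /mxtrace.
rewrite (big_morph (@complex.Re R) (@ReD R) (erefl : complex.Re (0 : C) = 0)).
apply: eq_bigr => i _; rewrite mxE.
rewrite (big_morph (@complex.Re R) (@ReD R) (erefl : complex.Re (0 : C) = 0)).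
apply: eq_bigr => j _.
have -> : A j i = Num.conj (A i j) by rewrite -{1}hA !mxE.
by case: (A i j) => x y /=; rewrite mulrN opprK.
Qed.

Lemma hsdot_ge0 A : is_hermitian A -> 0 <= hsdot A A.
Proof.
move=> hA; rewrite hsdot_herm//.
by do 2 (apply: sumr_ge0 => ? _); rewrite addr_ge0 ?sqr_ge0.
Qed.

Lemma hsdot_eq0 A : is_hermitian A -> hsdot A A = 0 -> A = 0.
Proof.
move=> hA; rewrite hsdot_herm// => /eqP.
rewrite psumr_eq0 => [|i _]; last by apply: sumr_ge0 => j _; rewrite addr_ge0 ?sqr_ge0.
move=> /allP h; apply/matrixP => i j; rewrite mxE.
have := h i (mem_index_enum i); rewrite psumr_eq0 => [|k _]; last first.
  by rewrite addr_ge0 ?sqr_ge0.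
move=> /allP /(_ j (mem_index_enum j)) /=.
rewrite paddr_eq0 ?sqr_ge0// !sqrf_eq0 => /andP[/eqP x0 /eqP y0].
by case: (A i j) x0 y0 => x y /= -> ->.
Qed.

Lemma hsdot_CauchySchwarz A B : is_hermitian A -> is_hermitian B ->
  hsdot A B ^+ 2 <= hsdot A A * hsdot B B.
Proof.
move=> hA hB; have := hsdot_ge0 hB; rewrite le_eqVlt => /predU1P[/esym B0|B0].
  rewrite B0 (hsdot_eq0 hB B0) /hsdot mulmx0 mxtrace0 /= mulr0 expr0n//.
(* A multiple of the component of [A] orthogonal to [B], scaled to avoid division; its squared norm
   is [hsdot B B] times the Cauchy-Schwarz gap. *)
pose Y := (hsdot B B)%:C%C *: A + - ((hsdot A B)%:C%C *: B).
have hY : is_hermitian Y by apply: hermitianD; [|apply: hermitianN]; exact: hermitianZ.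
have := hsdot_ge0 hY.
rewrite /Y hsdotDr hsdotNr !hsdotZr !hsdotDl !hsdotNl !hsdotZl (hsdotC B A).
rewrite (_ : _ - _ = hsdot B B * (hsdot A A * hsdot B B - hsdot A B ^+ 2)); last by ring.
by rewrite pmulr_rge0// subr_ge0.
Qed.

(* A and B lie on the sphere of squared radius K, and X is tangent to it at B. *)
Lemma hsdot_tangent A B X K : 0 < K ->
  is_hermitian A -> is_hermitian B -> is_hermitian X ->
  hsdot A A = K -> hsdot B B = K -> hsdot B X = 0 ->
  `|hsdot A X / K| <= Num.sqrt (hsdot X X / K) * Num.sqrt (1 - (hsdot A B / K) ^+ 2).
Proof.
move=> K0 hA hB hX AA BB BX.
have X0 := hsdot_ge0 hX.
(* The component of [A] orthogonal to [B]. It has the same product with [X] as [A], and its squared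
   norm carries the factor one minus the squared cosine. *)
pose Y := A + - ((hsdot A B / K)%:C%C *: B).
have hY : is_hermitian Y by apply: hermitianD => //; apply/hermitianN/hermitianZ.
have YX : hsdot Y X = hsdot A X by rewrite /Y hsdotDl hsdotNl hsdotZl BX mulr0 oppr0 addr0.
have YY : hsdot Y Y = K * (1 - (hsdot A B / K) ^+ 2).
  rewrite /Y hsdotDr hsdotNr !hsdotZr !hsdotDl !hsdotNl !hsdotZl (hsdotC B A) AA BB.
  by field; rewrite gt_eqF.
rewrite -sqrtrM ?divr_ge0 ?(ltW K0)// -sqrtr_sqr; apply: ler_wsqrtr.
rewrite expr_div_n ler_pdivrMr ?exprn_gt0// -YX.
apply: le_trans (hsdot_CauchySchwarz hY hX) _; rewrite YY.
rewrite (_ : _ * _ = hsdot X X / K * (1 - (hsdot A B / K) ^+ 2) * K ^+ 2)//.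
by field; rewrite gt_eqF.
Qed.

Lemma hsdot_cos_bound A B K : 0 < K -> is_hermitian A -> is_hermitian B ->
  hsdot A A = K -> hsdot B B = K -> -1 <= hsdot A B / K <= 1.
Proof.
move=> K0 hA hB AA BB.
rewrite -ler_norml -(@ler_pXn2r _ 2) ?nnegrE// expr1n real_normK ?num_real//.
rewrite expr_div_n ler_pdivrMr ?exprn_gt0// mul1r.
by rewrite (le_trans (hsdot_CauchySchwarz hA hB))// AA BB.
Qed.

Lemma maxmixed_hermitian : is_hermitian (maxmixed R N).
Proof. by rewrite /is_hermitian adjmx_scalar fmorphV rmorph_nat. Qed.

(** Each cross term and the square of [maxmixed] equal [1/N]. Hence [Theta] is the angle between the
    traceless parts, that is, between the Bloch vectors. *)
Lemma hsdot_traceless A B : (0 < N)%N -> \tr A = 1 -> \tr B = 1 ->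
  hsdot (A - maxmixed R N) (B - maxmixed R N) = hsdot A B - N%:R^-1.
Proof.
move=> N0 trA trB; rewrite hsdotDr hsdotNr !hsdotDl !hsdotNl.
have ReV : complex.Re (N%:R^-1 : C) = N%:R^-1.
  by rewrite -(rmorph_nat (real_complex R)) -fmorphV.
have dotM X : \tr X = 1 -> hsdot X (maxmixed R N) = N%:R^-1.
  by move=> trX; rewrite /hsdot mul_mx_scalar mxtraceZ trX mulr1.
rewrite (hsdotC (maxmixed R N) B) !dotM//; last first.
  by rewrite mxtrace_scalar -[_ *+ _]mulr_natr mulVf// pnatr_eq0 -lt0n.
by rewrite subrr subr0.
Qed.

End hermitian.

(** * Unitary evolution *)

Section velocity.
Context {R : realType} {N : nat}.
Local Notation C := (R[i]).
Implicit Types A B H rho : 'M[C]_N.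

(** Right-hand side of the von Neumann equation for a state driven by [H]. *)
Definition velocity H rho : 'M[C]_N := - 'i *: (H *m rho - rho *m H).

Lemma velocity_hermitian H rho :
  is_hermitian H -> is_hermitian rho -> is_hermitian (velocity H rho).
Proof.
move=> hH hr; rewrite /is_hermitian /velocity adjmxZ adjmxD adjmxN !adjmxM hH hr.
by rewrite rmorphN /= conjCi opprK scaleNr -scalerN opprB.
Qed.

Lemma mxtrace_velocity H rho : \tr (velocity H rho) = 0.
Proof. by rewrite mxtraceZ mxtraceD raddfN /= mxtrace_mulC subrr mulr0. Qed.

Lemma hsdot_velocity_orth H rho : hsdot rho (velocity H rho) = 0.
Proof.
rewrite /hsdot -scalemxAr mxtraceZ mulmxBr mxtraceD raddfN /=.
by rewrite mulmxA [\tr (rho *m (rho *m H))]mxtrace_mulC subrr mulr0.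
Qed.

Lemma hsdot_velocity_maxmixed H rho B :
  hsdot (B - maxmixed R N) (velocity H rho) = hsdot B (velocity H rho).
Proof.
rewrite hsdotDl hsdotNl [X in _ - X](_ : _ = 0) ?subr0//.
by rewrite /hsdot mul_scalar_mx mxtraceZ mxtrace_velocity mulr0.
Qed.

(** The square of [-i] is [-1], and cyclicity of the trace merges the four terms of the squared
    commutator in pairs. The numerator in [QTheta_integrand] is thus a squared speed. *)
Lemma hsdot_velocity H rho : hsdot (velocity H rho) (velocity H rho) =
  2 * complex.Re (\tr (rho *m rho *m (H *m H) - (rho *m H) *m (rho *m H))).
Proof.
rewrite /hsdot /velocity -scalemxAl -scalemxAr scalerA mulrNN -expr2 sqrCi.
rewrite scaleN1r raddfN /= mulmxBr !mulmxBl !raddfB /=.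
have -> : \tr (rho *m H *m (H *m rho)) = \tr (rho *m rho *m (H *m H)).
  by rewrite mxtrace_mulC -!mulmxA mxtrace_mulC -!mulmxA.
have -> : \tr (H *m rho *m (rho *m H)) = \tr (rho *m rho *m (H *m H)).
  by rewrite -mulmxA mxtrace_mulC -!mulmxA.
have -> : \tr (H *m rho *m (H *m rho)) = \tr (rho *m H *m (rho *m H)).
  by rewrite -mulmxA mxtrace_mulC -!mulmxA.
by case: (\tr _) => x y; case: (\tr _) => z w /=; ring.
Qed.

Lemma QTheta_integrandE H rho : (0 < N)%N ->
  QTheta_integrand rho H =
  Num.sqrt (hsdot (velocity H rho) (velocity H rho) / (hsdot rho rho - N%:R^-1)).
Proof.
move=> N0; rewrite /QTheta_integrand hsdot_velocity; congr (Num.sqrt (_ / _)).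
have N0' : (N%:R : C) != 0 by rewrite pnatr_eq0 -lt0n.
(* The scalar matrix [1/N^2] has trace [N / N^2 = 1/N]. *)
rewrite mxtraceD raddfN /= mxtrace_scalar -[_ *+ _]mulr_natr expr2 invfM mulfVK//.
by rewrite ReD ReN -(rmorph_nat (real_complex R)) -fmorphV.
Qed.

End velocity.

(** * Conservation laws and measurability along the evolution *)

Section evolution.
Context {R : realType} {N : nat}.
Local Notation C := (R[i]).
Variables (T : R) (H U : R -> 'M[C]_N) (rho : 'M[C]_N).
Hypothesis hH : forall t, t \in `[0, T]%R -> is_hermitian (H t).
Hypothesis schrU : schrodinger_evolution T H U.
Hypothesis hrho : is_hermitian rho.

Let hH' t : 0 < t < T -> adjmx (H t) = H t.
Proof. by move=> /andP[t0 tT]; apply: hH; rewrite in_itv /= !ltW. Qed.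

Lemma schrodinger_primitive : mxprimitive T U (fun t => - 'i *: (H t *m U t)).
Proof.
by case: schrU => _ cRe cIm dU i j; split; split => // t tT; have [] := dU t tT i j.
Qed.

(** Since [H t] is Hermitian, the two terms [i U^* H U] and [-i U^* H U] in the derivative of
    [U^* U] cancel, so this product keeps its initial value. *)
Lemma schrodinger_unitary t : 0 <= t <= T -> adjmx (U t) *m U t = 1%:M.
Proof.
move=> tT.
have /mxprimitive_ext UU := mxprimitiveM (mxprimitive_adj schrodinger_primitive)
  schrodinger_primitive.
have {}UU : mxprimitive T (fun s => adjmx (U s) *m U s) (fun=> 0).
  apply: UU => s sT; rewrite adjmxZ adjmxM hH'// rmorphN /= conjCi opprK.
  by rewrite -scalemxAr -scalemxAl mulmxA -scalerDl addNr scale0r.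
have U0 : adjmx (U 0) *m U 0 = 1%:M.
  by case: schrU => -> _ _ _; rewrite adjmx_scalar rmorph1 mulmx1.
rewrite -U0; apply/matrixP => i j; case: (UU i j) => Re0 Im0.
have := primitive0_const Re0 _ tT; have := primitive0_const Im0 _ tT.
move=> /= imE reE; apply/eqP; rewrite eq_complex imE ?reE ?eqxx// => s _; by rewrite mxE.
Qed.

Lemma evolve_primitive :
  mxprimitive T (evolve U rho) (fun t => velocity (H t) (evolve U rho t)).
Proof.
apply: mxprimitive_ext (mxprimitiveM (mxprimitiveM schrodinger_primitive
  (mxprimitive_cst T rho)) (mxprimitive_adj schrodinger_primitive)) => t tT.
rewrite mulmx0 add0r adjmxZ adjmxM hH'// rmorphN /= conjCi opprK /velocity /evolve.
by rewrite -!scalemxAl -!scalemxAr !mulmxA scalerBr !scaleNr opprK addrC.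
Qed.

Lemma evolve_hermitian t : is_hermitian (evolve U rho t).
Proof. by rewrite /is_hermitian /evolve !adjmxM adjmxK hrho mulmxA. Qed.

Lemma mxtrace_evolve t : 0 <= t <= T -> \tr (evolve U rho t) = \tr rho.
Proof.
by move=> tT; rewrite /evolve mxtrace_mulC mulmxA schrodinger_unitary// mul1mx.
Qed.

Lemma hsdot_evolve t : 0 <= t <= T ->
  hsdot (evolve U rho t) (evolve U rho t) = hsdot rho rho.
Proof.
move=> tT; rewrite /hsdot /evolve -!mulmxA (mulmxA (adjmx (U t)) (U t)).
by rewrite schrodinger_unitary// mul1mx mxtrace_mulC -!mulmxA schrodinger_unitary// mulmx1.
Qed.

(** Measurability comes from the state and not from [H]: the entries of the velocity are derivatives
    of the entries of the evolved state, and the integrand is a continuous function of them. *)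
Lemma measurable_QTheta_integrand : (0 < N)%N ->
  measurable_fun `]0, T[ (fun t => QTheta_integrand (evolve U rho t) (H t)).
Proof.
move=> N0.
pose V t := velocity (H t) (evolve U rho t).
pose K := hsdot rho rho - N%:R^-1.
pose S t := \sum_(i < N) \sum_(j < N) (complex.Re (V t i j) ^+ 2 + complex.Im (V t i j) ^+ 2).
apply: (@eq_measurable_fun _ _ _ _ _ (fun t => Num.sqrt (S t / K))).
  move=> t /set_mem /=; rewrite in_itv /= => tT.
  have tT' : 0 <= t <= T by case/andP: tT => *; rewrite !ltW.
  rewrite QTheta_integrandE// hsdot_evolve// hsdot_herm//.
  by apply: velocity_hermitian; [exact: hH'|exact: evolve_hermitian].
apply: measurableT_comp.
  by apply: continuous_measurable_fun; exact: sqrt_continuous.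
apply: measurable_funM => //.
apply: measurable_sum => i; apply: measurable_sum => j.
have [[cR dR] [cI dI]] := evolve_primitive i j.
by apply: measurable_funD; apply: measurable_funX; [exact: measurable_fun_derivative cR dR|
  exact: measurable_fun_derivative cI dI].
Qed.

End evolution.

(** * The angle bounded by the integrated speed *)

Lemma Theta_le_integral (R : realType) (N : nat) (rho : 'M[R[i]]_N) (T : R)
    (H U : R -> 'M[R[i]]_N) : (0 < N)%N -> is_hermitian rho -> \tr rho = 1 ->
  rho <> maxmixed R N -> 0 < T ->
  (forall t, t \in `[0, T]%R -> is_hermitian (H t)) -> schrodinger_evolution T H U ->
  ((Theta rho (evolve U rho T))%:E <= \int[lebesgue_measure]_(t in `]0%R, T[)
     (QTheta_integrand (evolve U rho t) (H t))%:E)%E.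
Proof.
move=> N0 hrho trrho rhoM T0 hH schrU.
pose K := hsdot rho rho - N%:R^-1.
pose A B := B - maxmixed R N : 'M[R[i]]_N.
have hA B : is_hermitian B -> is_hermitian (A B).
  by move=> hB; apply: hermitianD => //; apply/hermitianN/maxmixed_hermitian.
have hevo := evolve_hermitian U hrho.
(* [K] is the squared length of the traceless part of [rho], which vanishes only at the maximally
   mixed state. *)
have K0 : 0 < K.
  rewrite /K -hsdot_traceless// lt_neqAle hsdot_ge0 ?andbT; last exact: hA.
  apply/eqP => /esym/(hsdot_eq0 (hA _ hrho)) /eqP.
  by rewrite subr_eq0 => /eqP.
have AA : hsdot (A rho) (A rho) = K by rewrite hsdot_traceless.
have trevo t : 0 <= t <= T -> \tr (evolve U rho t) = 1.
  by move=> tT; rewrite (mxtrace_evolve rho hH schrU).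
have BB t : 0 <= t <= T -> hsdot (A (evolve U rho t)) (A (evolve U rho t)) = K.
  by move=> tT; rewrite hsdot_traceless ?trevo// (hsdot_evolve rho hH schrU).
(* The cosine of the angle between the traceless parts of the initial and the current state;
   [acos (c T)] is [Theta]. *)
pose c t := (hsdot rho (evolve U rho t) - N%:R^-1) / K.
have cE t : 0 <= t <= T -> c t = hsdot (A rho) (A (evolve U rho t)) / K.
  by move=> tT; rewrite hsdot_traceless ?trevo.
have c11 t : 0 <= t <= T -> -1 <= c t <= 1.
  move=> tT; rewrite cE//; apply: hsdot_cos_bound => //; [exact: hA|exact: hA|exact: BB].
have oo_cc t : 0 < t < T -> 0 <= t <= T by case/andP => *; rewrite !ltW.
have cp : primitive T c (fun t => hsdot rho (velocity (H t) (evolve U rho t)) / K).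
  have [+ _] := mxprimitive_trace (mxprimitiveM (mxprimitive_cst T rho)
    (evolve_primitive rho hH schrU)).
  move=> /primitiveD /(_ (primitive_cst T (- N%:R^-1))).
  move=> /primitiveM /(_ (primitive_cst T K^-1)).
  apply: primitive_ext => // t _.
  by rewrite mulr0 add0r addr0 mul0mx addr0.
case: cp => cc dcc.
apply: (@acos_le_integral R c _ _ T T0 cc dcc) => //.
- rewrite /c (_ : evolve U rho 0 = rho) ?divff ?gt_eqF//.
  by case: schrU => U0 _ _ _; rewrite /evolve U0 adjmx_scalar conjC1 mul1mx mulmx1.
- by move=> t _; exact: sqrtr_ge0.
- move=> t tT; rewrite QTheta_integrandE// (hsdot_evolve rho hH schrU) ?oo_cc//.
  rewrite -hsdot_velocity_maxmixed (cE _ (oo_cc _ tT)).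
  apply: hsdot_tangent => //; rewrite ?BB ?oo_cc//; try exact: hA.
  + apply: velocity_hermitian => //; apply: hH; rewrite in_itv /=; exact: oo_cc.
  + by rewrite hsdot_velocity_maxmixed hsdot_velocity_orth.
- exact: measurable_QTheta_integrand.
Qed.

Local Close Scope classical_set_scope.

Theorem theorem1 (R : realType) (N : nat) (rho sigma : 'M[complex R]_N)
  (T : R) (H U : R -> 'M[complex R]_N) :
  (0 < N)%N ->
  is_density rho -> is_density sigma ->
  char_poly rho = char_poly sigma ->
  rho <> maxmixed R N ->
  0 < T ->
  (forall t, t \in `[0, T] -> is_hermitian (H t)) ->
  schrodinger_evolution T H U ->
  evolve U rho T = sigma ->
  T >= Theta rho sigma / QTheta T H U rho.
Proof.
move=> N0 [hrho _ trrho] _ _ rhoM T0 hH schrU <-.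
have Th := Theta_le_integral N0 hrho trrho rhoM T0 hH schrU.
(* The endpoints are a null set, so the closed interval in [QTheta] may be replaced by the open
   one. *)
rewrite /QTheta /Rintegral integral_itv_bndoo; last first.
  by apply/measurable_EFinP; exact: measurable_QTheta_integrand.
move: Th; have : (0 <= \int[lebesgue_measure]_(t in `]0%R, T[)
    (QTheta_integrand (evolve U rho t) (H t))%:E)%E.
  by apply: integral_ge0 => t _; rewrite lee_fin sqrtr_ge0.
(* If the integral is +oo then its real part [fine +oo] is 0, so the bound is _ / 0 = 0. *)
case: (integral _ _ _) => [I| |] //=; last by rewrite mulr0 invr0 mulr0 (ltW T0).
(* If the integral is zero then so is [QTheta], whose inverse is 0 by convention, and the bound
   reads [0 <= T]. *)
rewrite !lee_fin le_eqVlt => /predU1P[<- _|I0 Th].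
  by rewrite mulr0 invr0 mulr0 ltW.
(* For a positive integral [I], the bound is [T * (Theta / I)] with [Theta / I <= 1]. *)
by rewrite invfM invrK mulrCA ler_piMr ?(ltW T0)// ler_pdivrMr// mul1r.
Qed.
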